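(* Let $m\ge2$ be an integer and $k\in\{1,2,\ldots,m-1\}$. (i) If $\gcd(m,k)=1$, then $$\max\mathcal L_{m,k}=\mathbf w_{k/m},\qquad \min\mathcal P_{m,k}=\mathbb L(\mathbf w_{k/m}).$$ (ii) If $\gcd(m,k)=d\ge2$, then $$\max\mathcal L_{m,k}=\mathbf w_{k/m}\bullet(01^{d-1}),\qquad\min\mathcal P_{m,k}=\mathbf w_{k/m}\bullet(10^{d-1}).$$
   Context: $\{0,1\}^*$ is the set of finite words over $\{0,1\}$; max and min are with respect to the lexicographical order. $\mathbb L(\mathbf w)$ denotes the lexicographically largest cyclic permutation of $\mathbf w$. If $\mathbf w$ ends with $0$, $\mathbf w^+$ is $\mathbf w$ with last digit changed to $1$; if $\mathbf w$ ends with $1$, $\mathbf w^-$ is $\mathbf w$ with last digit changed to $0$. A word is a Lyndon word if it is not a proper power of a shorter word and is the lexicographically smallest of its cyclic permutations. $\mathcal L_{m,k}$ is the set of Lyndon words of length $m$ with precisely $k$ digits equal to $1$, and $\mathcal P_{m,k}=\{\mathbb L(\mathbf w):\mathbf w\in\mathcal L_{m,k}\}$. For a rational $p/q\in(0,1)$ with $\gcd(p,q)=1$, let $R_{p/q}:\mathbb R/\mathbb Z\to\mathbb R/\mathbb Z$, $x\mapsto x+p/q\pmod1$. The Farey word $\mathbf w_{p/q}=w_1\ldots w_q$ is given by $w_k=1$ if $0\in(R_{p/q}^{k-1}(0),R_{p/q}^k(0)]$ (arc of the circle), and $w_k=0$ otherwise; equivalently $w_k=\lfloor kp/q\rfloor-\lfloor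 (k-1)p/q\rfloor$. If $\gcd(p,q)=d>1$, $\mathbf w_{p/q}:=\mathbf w_{(p/d)/(q/d)}$. Farey words of length at least two are Lyndon words. For a Lyndon word $\mathbf s$ of length at least two (it begins with $0$ and ends with $1$) and $\mathbf r=r_1\ldots r_n\in\{0,1\}^*$, define $\mathbf s\bullet\mathbf r=\mathbf w_1\ldots\mathbf w_n$, where $\mathbf w_1=\mathbf s^-$ if $r_1=0$, $\mathbf w_1=\mathbb L(\mathbf s)^+$ if $r_1=1$, and for $1\le k<n$, $\mathbf w_{k+1}$ equals $\mathbb L(\mathbf s)$, $\mathbb L(\mathbf s)^+$, $\mathbf s^-$, $\mathbf s$ according as $r_kr_{k+1}=00,01,10,11$. *)

(* Defs.v *)
From HB Require Import structures.
From mathcomp Require Import all_boot all_order all_algebra.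
From mathcomp Require Import zify ring lra.

Set Implicit Arguments.
Unset Strict Implicit.
Unset Printing Implicit Defensive.

Import Order.TTheory GRing.Theory Num.Theory.

(* Digit 0 is [false], digit 1 is [true]. The alias [seqlexi] carries the
   lexicographical order, in which a proper prefix precedes its extensions. *)
Notation word := (seqlexi bool).

Definition is_max (A : word -> Prop) (w : word) : Prop :=
  A w /\ forall v, A v -> (v <= w)%O.

Definition is_min (A : word -> Prop) (w : word) : Prop :=
  A w /\ forall v, A v -> (w <= v)%O.

Definition wpow (n : nat) (v : word) : word := flatten (nseq n v).

Definition lyndon (w : word) : Prop :=
  ~ (exists (v : word) (n : nat), [/\ 1 < n, size v < size w & w = wpow n v])
  /\ forall i, (w <= (rot i w : word))%O.

Definition max_rot (w : word) : word :=
  \big[Order.max/w]_(i < size w) (rot i w : word).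

(* Meaningful only on words ending with 0 (resp. with 1), the only case in
   which they are used. *)
Definition wplus (w : word) : word := set_nth false w (size w).-1 true.
Definition wminus (w : word) : word := set_nth false w (size w).-1 false.

Definition lyndon_words (m k : nat) (w : word) : Prop :=
  [/\ lyndon w, size w = m & count_mem true w = k].

Definition max_lyndon_words (m k : nat) (v : word) : Prop :=
  exists2 w, lyndon_words m k w & v = max_rot w.

Definition bullet_head (s : word) (a : bool) : word :=
  if a then wplus (max_rot s) else wminus s.

Definition bullet_block (s : word) (a b : bool) : word :=
  match a, b with
  | false, false => max_rot s
  | false, true  => wplus (max_rot s)
  | true,  false => wminus s
  | true,  true  => s
  end.

Definition bullet (s r : word) : word :=
  if r is a :: r' then
    flatten (bullet_head s a :: pairmap (bullet_block s) a r')
  else [::].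

Local Open Scope ring_scope.

Definition frac (x : rat) : rat := x - (Num.floor x)%:~R.

(* Points of R/Z are represented in [0, 1[; rationals suffice, because the
   orbit of 0 under a rational rotation is rational. *)
Definition rotation (a x : rat) : rat := frac (x + a).

(* [z] lies on the positively oriented arc (x, y] of the circle, x <> y. *)
Definition in_arc (x y z : rat) : bool := 0 < frac (z - x) <= frac (y - x).

(* The length is the reduced denominator of [a], so no coprimality assumption
   is needed on a fraction p / q denoting [a]; the entry of index [j] (from 0)
   is the digit w_{j+1}. *)
Definition farey_word (a : rat) : word :=
  mkseq (fun j => in_arc (iter j (rotation a) 0) (iter j.+1 (rotation a) 0) 0)
        `|denq a|%N.

Lemma frac_itv x : 0 <= frac x < 1.
Proof.
have /andP[] := floor_itv x.
by rewrite /frac intrD; move=> *; apply/andP; split; lra.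
Qed.

Lemma floorE (x : rat) (n : int) : n%:~R <= x < n%:~R + 1 -> Num.floor x = n.
Proof. by move=> h; apply: floor_def; rewrite !intrD. Qed.

Lemma frac_eq (x y : rat) (n : int) : 0 <= y < 1 -> x = y + n%:~R -> frac x = y.
Proof.
move=> hy ->; rewrite /frac (@floorE _ n); first by ring.
by apply/andP; split; lra.
Qed.

Lemma fracDz x (n : int) : frac (x + n%:~R) = frac x.
Proof.
apply: (frac_eq (n := n + Num.floor x)); first exact: frac_itv.
by rewrite intrD /frac; ring.
Qed.

Lemma iter_rotation a j : iter j (rotation a) 0 = frac (a *+ j).
Proof.
elim: j => [|j IH] /=; first by rewrite mulr0n /frac floor0 subr0.
rewrite IH /rotation -[RHS](fracDz _ (- Num.floor (a *+ j))); congr frac.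
by rewrite mulrSr {1}/frac intrN; ring.
Qed.

Lemma nth_farey_word (a : rat) (j : nat) : 0 < a < 1 -> (j < `|denq a|)%N ->
  (nth false (farey_word a) j)%:Z = Num.floor (a *+ j.+1) - Num.floor (a *+ j).
Proof.
move=> ha hj; rewrite nth_mkseq // !iter_rotation /in_arc.
have -> : frac (frac (a *+ j.+1) - frac (a *+ j)) = a.
  apply: (frac_eq (n := Num.floor (a *+ j) - Num.floor (a *+ j.+1))).
    by apply/andP; split; lra.
  by rewrite intrD intrN /frac mulrSr; ring.
rewrite sub0r; set x := a *+ j.
have := frac_itv x; set y := frac x => hy.
have xE : x = y + (Num.floor x)%:~R by rewrite /y /frac; ring.
have fN : frac (- y) = if y == 0 then 0 else 1 - y.
  case: eqP => [->|/eqP y0].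
    by apply: (frac_eq (n := 0)); [lra|rewrite oppr0 addr0].
  apply: (frac_eq (n := -1)); last by rewrite intrN; ring.
  have y1 : 0 < y by rewrite lt_def y0; case/andP: hy.
  by apply/andP; split; lra.
have xSE : a *+ j.+1 = y + a + (Num.floor x)%:~R by rewrite mulrSr -/x {1}xE; ring.
rewrite fN xSE; case: eqP => [y0|/eqP y0].
  rewrite ltxx /= (@floorE _ (Num.floor x)) ?subrr //.
  by apply/andP; split; lra.
have [h|h] := leP (1 - y) a.
  rewrite (@floorE _ (Num.floor x + 1)); last first.
    by rewrite intrD; apply/andP; split; lra.
  by rewrite (_ : 0 < 1 - y) /=; [rewrite addrC addKr|lra].
rewrite andbF (@floorE _ (Num.floor x)) ?subrr //.
by apply/andP; split; lra.
Qed.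

(* Main.v *)
Require Import Defs.
From mathcomp Require Import all_boot all_order all_algebra.
From mathcomp Require Import zify.
Import Order.TTheory GRing.Theory Num.Theory.

Set Implicit Arguments.
Unset Strict Implicit.
Unset Printing Implicit Defensive.

(** Fix a word [w] of length [m] with [k] ones and read it periodically. Let
    [psum w n] be the number of ones among the first [n] letters. Prefix sums
    control the lexicographic order (lemma [lexi_psum]): at the first position
    where they differ, the word with the larger prefix sum is the larger word.

    Write [m = d * q] and [k = d * p] with [p] and [q] coprime. The drift
    [q * psum w i - p * i] is periodic in [i], so it has a maximum, attained at
    some peak [i]. Reading [w] from a peak, no prefix of length [n] has more
    than [n * p / q] ones. The Farey word of slope [p / q] is the word whose
    prefix sums are exactly the integer parts of [n * p / q]
    ([size_psum_farey_word]), so the rotation of [w] at a peak, and with it the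
    smallest rotation of [w], lies below the Farey word [s] when [d = 1]
    ([lyndon_le_farey]).

    When [d > 1], the same bound is reached by [s] repeated [d] times, which is
    a proper power. The word [s^- L(s)^+ s ... s] obtained by substitution has
    the same prefix sums as this power, except that the sum at [q], modulo [m],
    is smaller by one ([psum_bullet]). If every window of length [q] starting
    at a peak read [s], each peak would be followed by another one [q] letters
    later, and [w] would be invariant under the rotation by [q]. So, for [w]
    primitive, some window at a peak is not [s], and this is what it takes for
    the rotation at that peak to lie below the substituted word
    ([lyndon_le_farey_bullet]). That both candidates are Lyndon words follows
    from the superadditivity of the integer part ([farey_lyndon],
    [farey_bullet_lyndon]).

    The statements about largest rotations are mirror images of these.
    Exchanging the digits reverses the order on words of equal length, hence
    turns the Lyndon words with [k] ones into the largest rotations of the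
    Lyndon words with [m - k] ones ([is_min_max_lyndon]). The largest rotation
    of the Farey word of slope [p / q] is the complement of the Farey word of
    slope [1 - p / q] ([max_rot_farey]), so complementation exchanges the two
    substitutions as well ([compl_bullet]). *)

(** * Periodic reading of words *)

(** The letters of the infinite word [w w w ...]; reading past the end of [w]
    makes rotations into shifts of the index. *)
Definition letter (w : seq bool) (j : nat) : bool := nth false w (j %% size w).
Definition psum (w : seq bool) (n : nat) : nat := \sum_(j < n) letter w j.

Lemma eq_letter (u v : seq bool) :
  size u = size v -> (forall j, j < size u -> letter u j = letter v j) -> u = v.
Proof.
move=> suv h; apply: (eq_from_nth (x0 := false)) => // j hj.
by have := h j hj; rewrite /letter -suv modn_small.
Qed.

Lemma letterD (w : seq bool) n j : letter w (n * size w + j) = letter w j.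
Proof. by rewrite /letter modnMDl. Qed.

Lemma letter_rot i (w : seq bool) j : i <= size w ->
  letter (rot i w) j = letter w (i + j).
Proof.
move=> hi; rewrite /letter size_rot.
have [s0|s0] := posnP (size w).
  by rewrite !nth_default ?size_rot ?s0.
rewrite /rot nth_cat size_drop.
have := ltn_pmod j s0; rewrite -(modnDmr i j); move: (j %% _) => r hr.
case: ifP => h; first by rewrite nth_drop modn_small //; lia.
rewrite nth_take; last by lia.
have -> : i + r = r - (size w - i) + size w by lia.
by rewrite modnDr modn_small //; lia.
Qed.

Lemma psumS (w : seq bool) n : psum w n.+1 = psum w n + letter w n.
Proof. by rewrite /psum big_ord_recr. Qed.

Lemma psum0 (w : seq bool) : psum w 0 = 0.
Proof. by rewrite /psum big_ord0. Qed.

Lemma psum_rot i (w : seq bool) n : i <= size w ->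
  psum w (i + n) = psum w i + psum (rot i w) n.
Proof.
move=> hi; elim: n => [|n IH]; first by rewrite addn0 psum0 addn0.
by rewrite addnS !psumS IH letter_rot // addnA.
Qed.

Lemma psum_take (w : seq bool) n : n <= size w -> psum w n = count_mem true (take n w).
Proof.
elim: n => [|n IH] hn; first by rewrite psum0 take0.
rewrite psumS IH; last exact: ltnW.
rewrite (take_nth false hn) -cats1 count_cat /= addn0 /letter modn_small //.
by case: (nth _ _ _).
Qed.

Lemma psum_size (w : seq bool) : psum w (size w) = count_mem true w.
Proof. by rewrite psum_take // take_size. Qed.

Lemma psumD (w : seq bool) c r :
  psum w (c * size w + r) = c * count_mem true w + psum w r.
Proof.
rewrite -psum_size; elim: c => [|c IH]; first by [].
rewrite mulSn -addnA psum_rot // rot_size IH; lia.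
Qed.

Lemma eq_psum (u v : seq bool) : size u = size v ->
  (forall n, n <= size u -> psum u n = psum v n) -> u = v.
Proof.
move=> suv h; apply: eq_letter => // j hj.
by have := h j.+1 hj; rewrite !psumS h ?(ltnW hj) // => /addnI /(congr1 odd); rewrite !oddb.
Qed.

Lemma lexi_nth (u v : seq bool) : size u = size v ->
  (forall j, j < size u -> (forall i, i < j -> nth false u i = nth false v i) ->
     nth false u j <= nth false v j) -> ((u : word) <= v)%O.
Proof.
elim: u v => [|a u IH] [|b v] //= [suv] h.
rewrite lexi_cons; have := h 0 isT; move=> /= /(_ (fun i => ltac:(by []))).
move=> hab; apply/andP; split; first by case: a b hab {h} => [] [].
apply/implyP => hba; apply: IH => // j hj hij.
apply: (h j.+1) => // -[|i] //= hi; last exact: hij.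
by case: a b hab hba {h} => [] [].
Qed.

(** The sums have to be compared only at the first place where they differ,
    which is what allows a candidate whose prefix sums are not maximal
    everywhere. *)
Lemma lexi_psum (u v : seq bool) : size u = size v ->
  (forall j, j < size u -> (forall n, n <= j -> psum u n = psum v n) ->
     psum u j.+1 <= psum v j.+1) -> ((u : word) <= v)%O.
Proof.
move=> suv h; apply: lexi_nth => // j hj hij.
have E n : n <= j -> psum u n = psum v n.
  move=> hn; rewrite /psum; apply: eq_bigr => i _.
  by rewrite /letter -suv modn_small ?hij //; have := ltn_ord i; lia.
have := h j hj E; rewrite !psumS E // leq_add2l.
by rewrite /letter -suv modn_small.
Qed.

(** * Powers *)

Lemma size_wpow n (v : seq bool) : size (wpow n v) = n * size v.
Proof. by rewrite /wpow size_flatten /shape map_nseq sumn_nseq mulnC. Qed.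

Lemma letter_wpow n (v : seq bool) j : 0 < n -> letter (wpow n v) j = letter v j.
Proof.
move=> n0; rewrite /letter size_wpow.
have [s0|s0] := posnP (size v).
  by rewrite !nth_default ?size_wpow ?s0 ?muln0.
have : j %% (n * size v) < n * size v by rewrite ltn_mod muln_gt0 n0.
rewrite -(modn_dvdm j (dvdn_mull n (dvdnn (size v)))).
move: (j %% (n * size v)) => {n0}{}j.
elim: n j => // n IH j hj; rewrite /wpow /= nth_cat -/(wpow n v).
case: ifP => h; first by rewrite modn_small.
rewrite IH; last by lia.
by congr nth; rewrite -[in RHS](subnK (_ : size v <= j)) ?modnDr //; lia.
Qed.

Lemma psum_wpow n (v : seq bool) j : 0 < n -> psum (wpow n v) j = psum v j.
Proof. by move=> n0; apply: eq_bigr => i _; rewrite letter_wpow. Qed.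

(** The smallest positive period [e] under rotation divides the length, since
    the remainder of the length by [e] is again a period; the word is then a
    power of its prefix of length [e]. *)
Lemma rot_eq_wpow i (w : seq bool) : 0 < i < size w -> rot i w = w ->
  exists (v : seq bool) n, [/\ 1 < n, size v < size w & w = wpow n v].
Proof.
move=> hi hr.
have ex : exists i, (0 < i < size w) && (rot i w == w).
  by exists i; rewrite hi hr eqxx.
case: (ex_minnP ex) => e {hi hr i ex} /andP [/andP [e0 es] /eqP er] emin.
have per j : letter w (e + j) = letter w j by rewrite -letter_rot ?er // ltnW.
have perM c j : letter w (c * e + j) = letter w j.
  by elim: c => // c IH; rewrite mulSn -addnA per.
have ed : e %| size w.
  rewrite /dvdn -leqn0 leqNgt; apply/negP => r0.
  have re := ltn_pmod (size w) e0.
  have : e <= size w %% e; last by rewrite leqNgt re.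
  apply: emin; rewrite r0 (ltn_trans re es) /=; apply/eqP.
  apply: eq_letter => [|j _]; first exact: size_rot.
  rewrite letter_rot; last by lia.
  by rewrite -(perM (size w %/ e)) addnA -divn_eq -{1}[size w]mul1n letterD.
have sn : size w = (size w %/ e) * e by rewrite divnK.
have n1 : 1 < size w %/ e by rewrite ltn_divRL // mul1n.
exists (take e w), (size w %/ e); rewrite size_take es; split => //.
apply: eq_letter => [|j hj]; first by rewrite size_wpow size_take es.
rewrite letter_wpow; last by lia.
rewrite {2}/letter size_take es nth_take ?ltn_mod //.
rewrite {1}(divn_eq j e) perM /letter modn_small //.
exact: leq_trans (ltn_pmod j e0) (ltnW es).
Qed.

(** For a nonempty word, being a Lyndon word means being strictly smaller than
    each proper rotation. This form is the one that transfers to rotations and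
    complements. *)
Lemma lyndon_lt (w : seq bool) i : lyndon w -> 0 < i < size w ->
  ((w : word) < (rot i w : word))%O.
Proof.
move=> [np le] hi; rewrite lt_neqAle le andbT; apply/eqP => e.
by apply: np; apply: rot_eq_wpow hi _.
Qed.

Lemma lyndon_of_lt (w : seq bool) : 0 < size w ->
  (forall i, 0 < i < size w -> ((w : word) < (rot i w : word))%O) -> lyndon w.
Proof.
move=> w0 lt; split=> [[v [n [n1 vw e]]]|i].
  have v0 : 0 < size v by move: w0; rewrite e size_wpow muln_gt0 => /andP [].
  have := lt (size v); rewrite v0 vw => /(_ isT).
  rewrite (_ : rot (size v) w = w) ?ltxx //.
  apply: eq_letter => [|j _]; first exact: size_rot.
  rewrite letter_rot ?(ltnW vw) // e !letter_wpow ?(ltnW n1) //.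
  by rewrite -(mul1n (size v)) letterD.
case: (posnP i) => [->|i0]; first by rewrite rot0.
case: (ltnP i (size w)) => h; last by rewrite rot_oversize.
by apply: ltW; apply: lt; rewrite i0.
Qed.

(** * Complementation *)

Definition compl (w : seq bool) : seq bool := map negb w.

Lemma complK : involutive compl.
Proof. exact: (mapK negbK). Qed.

Lemma size_compl w : size (compl w) = size w.
Proof. exact: size_map. Qed.

Lemma compl_rot i w : compl (rot i w) = rot i (compl w).
Proof. exact: map_rot. Qed.

Lemma count_compl w : count_mem true (compl w) = size w - count_mem true w.
Proof.
rewrite -(count_predC (pred1 true) w) addKn count_map.
by apply: eq_count => -[].
Qed.

Lemma psum_compl w n : 0 < size w -> psum (compl w) n + psum w n = n.
Proof.
move=> w0; elim: n => [|n IH]; first by rewrite !psum0.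
rewrite !psumS {1}/letter size_compl (nth_map false) ?ltn_mod // -/(letter w n).
by case: letter => /=; lia.
Qed.

Lemma le_compl (u v : seq bool) : size u = size v ->
  ((compl u : word) <= (compl v : word))%O = ((v : word) <= (u : word))%O.
Proof.
elim: u v => [|a u IH] [|b v] //= [suv].
by rewrite !lexi_cons -(IH v suv); case: a b => [] [].
Qed.

Lemma lt_compl (u v : seq bool) : size u = size v ->
  ((compl u : word) < (compl v : word))%O = ((v : word) < (u : word))%O.
Proof. by move=> suv; rewrite !ltNge le_compl. Qed.

(** * Largest rotations *)

Lemma rotE i (w : seq bool) : exists2 j, j <= size w & rot i w = rot j w.
Proof.
case: (leqP i (size w)) => h; first by exists i.
by exists 0; rewrite // rot0 rot_oversize // ltnW.
Qed.

Lemma rot_rotE i j (w : seq bool) :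
  exists2 l, l <= size w & rot i (rot j w) = rot l w.
Proof. by rewrite rot_rot_add; apply: rotE. Qed.

Lemma le_max_rot (w : seq bool) i : ((rot i w : word) <= max_rot w)%O.
Proof.
case: (ltnP i (size w)) => h.
  exact: (le_bigmax (w : word) (fun i : 'I_(size w) => rot i w : word) (Ordinal h)).
by rewrite rot_oversize //; apply: bigmax_ge_id.
Qed.

Lemma max_rot_eq (w v : seq bool) :
  (forall i, ((rot i w : word) <= (v : word))%O) -> (exists i, v = rot i w) -> max_rot w = v.
Proof.
move=> le [i e]; apply: le_anti; apply/andP; split; last by rewrite e le_max_rot.
by apply: bigmax_le => [|j _]; [rewrite -[X in (X <= _)%O](rot0 w); apply: le|apply: le].
Qed.

Lemma max_rotP (w : seq bool) : exists i, max_rot w = rot i w.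
Proof.
apply: (big_ind (fun v : word => exists i, v = rot i w)).
- by exists 0; rewrite rot0.
- by move=> x y [i ->] [j ->]; rewrite /Order.max; case: ifP; [exists j|exists i].
- by move=> i _; exists i.
Qed.

(** * Duality *)

(** A word is the largest rotation of a Lyndon word exactly when it is strictly
    larger than its proper rotations. *)
Lemma max_lyndon_compl m k (v : seq bool) : 0 < m -> k <= m ->
  max_lyndon_words m (m - k) v <-> lyndon_words m k (compl v).
Proof.
move=> m0 km; split=> [[w [lw] /(id : size (w : seq bool) = m -> _) sw cw ->]|[lv sv cv]].
  have [i e] := max_rotP w; have [j hj {}e] : exists2 j, j <= size w & max_rot w = rot j w.
    by rewrite e; apply: rotE.
  split; rewrite ?size_compl ?count_compl ?e ?size_rot //; last first.
    have /permP -> : perm_eq (rot j w) w by rewrite perm_rot.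
    by rewrite sw cw; lia.
  apply: lyndon_of_lt; rewrite size_compl size_rot sw // => l hl.
  rewrite -compl_rot lt_compl ?size_rot // lt_neqAle -e.
  have [l' _] := rot_rotE l j w; rewrite -e => E; rewrite {2}E le_max_rot andbT.
  rewrite e rot_rot; apply/eqP => /rot_inj h.
  by have := lyndon_lt (w := w) (i := l) lw; rewrite sw hl h ltxx => /(_ isT).
have {}sv : size v = m by rewrite -(size_compl v).
have {}cv : m - count_mem true v = k by rewrite -sv -count_compl.
have lt l : 0 < l < m -> ((rot l v : word) < (v : word))%O.
  move=> hl; rewrite -lt_compl ?size_rot // compl_rot.
  by apply: (lyndon_lt (w := compl v)) => //; rewrite size_compl sv.
have le l : ((rot l v : word) <= (v : word))%O.
  case: (posnP l) => [->|l0]; first by rewrite rot0.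
  case: (ltnP l m) => h; last by rewrite rot_oversize ?sv.
  by apply: ltW; apply: lt; rewrite l0.
have [i0 e0] := max_rotP (compl v).
have [i hi e] : exists2 i, i <= size v & max_rot (compl v) = rot i (compl v).
  by rewrite e0 -(size_compl v); apply: rotE.
have le' l : ((rot i v : word) <= rot l v)%O.
  by rewrite -le_compl ?size_rot // !compl_rot -e le_max_rot.
exists (rot i v); last first.
  symmetry; apply: max_rot_eq => [l|].
    by have [l' _ ->] := rot_rotE l i v.
  by exists (size (rot i v) - i); rewrite -/(rotr i (rot i v)) rotK.
split; rewrite ?size_rot //; last first.
  have /permP -> : perm_eq (rot i v) v by rewrite perm_rot.
  by have := count_size (pred1 true) v; rewrite sv; lia.
apply: lyndon_of_lt; rewrite ?size_rot ?sv // => l hl.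
have [l' _ E] := rot_rotE l i v.
rewrite lt_neqAle {2}E le' andbT rot_rot; apply/eqP => /rot_inj h.
by have := lt l hl; rewrite -h ltxx.
Qed.

Lemma is_min_max_lyndon m k (t : seq bool) : 0 < m -> k <= m ->
  is_max (lyndon_words m k) t -> is_min (max_lyndon_words m (m - k)) (compl t).
Proof.
move=> m0 km [tL tmax]; split; first by apply/max_lyndon_compl; rewrite // complK.
move=> v /max_lyndon_compl vL; have {}vL := vL m0 km.
have [_ sv _] := vL; have [_ st _] := tL.
by rewrite -(le_compl (u := v)) ?complK ?tmax // size_compl st -sv size_compl.
Qed.

(** * The cycle lemma *)

(** The drift [q * psum w i - p * i], with the negative terms moved across to
    stay in the natural numbers, is largest at [i]. *)
Definition peak p q (w : seq bool) i :=
  forall j, q * psum w j + p * i <= q * psum w i + p * j.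

Lemma peak_mod d p q w i : size w = d * q -> count_mem true w = d * p ->
  peak p q w i -> peak p q w (i %% size w).
Proof.
move=> sw cw h j; have := h j.
rewrite {1 2}(divn_eq i (size w)) psumD cw {2}sw; nia.
Qed.

(** The drift is periodic, so its maximum over one period is its maximum. *)
Lemma exists_peak d p q w : 0 < d * q -> size w = d * q -> count_mem true w = d * p ->
  exists2 i, i < size w & peak p q w i.
Proof.
move=> m0 sw cw; have s0 : 0 < size w by rewrite sw.
case: (@arg_maxnP _ (Ordinal s0) predT
  (fun i : 'I_(size w) => q * psum w i + p * (size w - i)) isT) => i _ imax.
exists i => // j; have := imax (Ordinal (ltn_pmod j s0)) isT => /=.
have := divn_eq j (size w); have := ltn_pmod j s0; have := ltn_ord i.
move: (j %/ _) (j %% _) => c r hi hr ->; rewrite psumD cw /geq.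
have -> : p * (size w - r) = p * size w - p * r by rewrite mulnBr.
have -> : p * (size w - i) = p * size w - p * i by rewrite mulnBr.
have := leq_mul (leqnn p) (ltnW hr); have := leq_mul (leqnn p) (ltnW hi).
by move: (nat_of_ord i) => {hi imax}i; rewrite sw; nia.
Qed.

Lemma peak_psum p q w i n : 0 < q -> i <= size w -> peak p q w i ->
  psum (rot i w) n <= n * p %/ q.
Proof.
move=> q0 hi /(_ (i + n)); rewrite psum_rot // leq_divRL //; lia.
Qed.

(** * The largest Lyndon word *)

Lemma lyndon_le_farey p q (w s : seq bool) : 0 < q ->
  (forall i, ((w : word) <= (rot i w : word))%O) ->
  size w = q -> count_mem true w = p -> size s = q ->
  (forall n, psum s n = n * p %/ q) -> ((w : word) <= s)%O.
Proof.
move=> q0 le sw cw ss ps.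
have [|||i hi /peak_psum H] := @exists_peak 1 p q w; rewrite ?mul1n //.
apply: le_trans (le i) _; apply: lexi_psum; rewrite ?size_rot ?sw // => j _ _.
by rewrite ps H // ltnW.
Qed.

(** At a peak [i] where the first [q] letters of [rot i w] are not [s], the
    word [rot i w] is below [t]. Its prefix sums are at most [n * p / q], so
    they can exceed those of [t] only at [q]; if they first differ from those
    of [t] there, [rot i w] has [p] ones in its first [q] letters and agrees
    with [s] on them. The rest of the proof finds such a peak. *)
Lemma lyndon_le_farey_bullet d p q (w s t : seq bool) : 1 < d -> 0 < q ->
  (forall i, 0 < i < d * q -> ((w : word) < (rot i w : word))%O) ->
  size w = d * q -> count_mem true w = d * p ->
  size s = q -> (forall n, psum s n = n * p %/ q) ->
  size t = d * q -> (forall n, psum t n + (n %% (d * q) == q) = n * p %/ q) ->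
  ((w : word) <= t)%O.
Proof.
move=> d1 q0 lt sw cw ss ps st pt.
have qm : q < d * q by rewrite -{1}(mul1n q) ltn_pmul2r.
have m0 : 0 < d * q by lia.
have le i : ((w : word) <= (rot i w : word))%O.
  case: (posnP i) => [->|i0]; first by rewrite rot0.
  case: (ltnP i (d * q)) => h; last by rewrite rot_oversize ?sw.
  by apply: ltW; apply: lt; rewrite i0.
rewrite leNgt; apply/negP => tw.
(* if w were above t, each window of length q at a peak would read s *)
have window i : i < size w -> peak p q w i ->
    forall j, j < q -> letter w (i + j) = letter s j.
  move=> hi ti j hj; rewrite -letter_rot ?(ltnW hi) //; apply/eqP/negPn/negP => nj.
  move: tw; rewrite ltNge => /negP; apply; apply: le_trans (le i) _.
  apply: lexi_psum; rewrite ?size_rot ?sw // => l hl E.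
  have H := peak_psum l.+1 q0 (ltnW hi) ti.
  have := pt l.+1; case: eqP => [e|_]; last by rewrite addn0 => ->.
  have lq : l.+1 = q.
    have : l.+1 = d * q \/ l.+1 < d * q by lia.
    by case=> h; [move: e; rewrite h modnn; lia|rewrite -e modn_small].
  rewrite lq mulKn // => ptq; rewrite lq mulKn // in H.
  case: (ltnP (psum t q) (psum (rot i w) q)) => // h.
  have E' n : n <= q -> psum (rot i w) n = psum s n.
    rewrite leq_eqVlt => /orP [/eqP ->|nq]; first by rewrite ps mulKn //; lia.
    rewrite E ?ps -?pt; last by lia.
    by rewrite modn_small ?(ltn_trans nq) // (ltn_eqF nq) addn0.
  move: nj; have := E' j.+1 hj; rewrite !psumS E'; last exact: ltnW.
  by move=> /addnI; do 2!case: letter.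
have [i hi ti] := exists_peak m0 sw cw.
have qw : q %| size w by rewrite sw dvdn_mull.
(* a window reading s has p ones, so its end is a peak again *)
have tq c : peak p q w (i + c * q) /\
    forall j, j < q -> letter w (i + c * q + j) = letter s j.
  have step i' : peak p q w i' -> forall j, j < q -> letter w (i' + j) = letter s j.
    move=> ti' j hj; rewrite -(window _ _ (peak_mod sw cw ti')) ?ltn_mod ?sw //.
    by rewrite {1}(divn_eq i' (size w)) -addnA letterD sw.
  suff tc : peak p q w (i + c * q) by split=> //; apply: step.
  elim: c => [|c IH]; first by rewrite addn0.
  have agree n : n <= q -> psum w (i + c * q + n) = psum w (i + c * q) + psum s n.
    elim: n => [|n IHn] hn; first by rewrite psum0 !addn0.
    by rewrite addnS !psumS IHn ?(ltnW hn) // (step _ IH) // addnA.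
  have := agree q (leqnn q); rewrite ps mulKn // -addnA -mulSnr => A.
  by move=> j; have := IH j; rewrite A; nia.
have per j : letter w (i + j) = letter s j.
  have [_ H] := tq (j %/ q).
  by rewrite {1}(divn_eq j q) addnA H ?ltn_mod // /letter ss modn_mod.
have : rot q w = w.
  apply: (@rot_inj i); rewrite rot_rot; apply: eq_letter; rewrite ?size_rot // => j _.
  rewrite !letter_rot ?size_rot ?(ltnW hi) ?sw ?(ltnW qm) // !per.
  by rewrite -{1}(mul1n q) -{1}ss letterD.
by have := lt q; rewrite q0 qm => /(_ isT) /[swap] ->; rewrite ltxx.
Qed.

(** * Farey words *)

Lemma floor_super p q i n : i * p %/ q + n * p %/ q <= (i + n) * p %/ q.
Proof.
have [->//|q0] := posnP q.
by rewrite leq_divRL // !mulnDl leq_add ?leq_trunc_div.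
Qed.

(** The gain is strict because [n * p / q] is not an integer whereas
    [(i + n) * p / q] is one. *)
Lemma floor_super_lt p q i n : coprime p q -> 0 < n < q -> q %| i + n ->
  i * p %/ q + n * p %/ q < (i + n) * p %/ q.
Proof.
move=> cpq hn qin; have q0 : 0 < q by lia.
have nd : n * p %% q != 0.
  rewrite -/(q %| n * p) Gauss_dvdl ?(coprime_sym q) //.
  by apply/negP => /(dvdn_leq _); lia.
have e : (i + n) * p %/ q * q = (i + n) * p by rewrite divnK ?dvdn_mulr.
rewrite -(ltn_pmul2r q0) e mulnDl [(i + n) * p]mulnDl.
have := leq_trunc_div (i * p) q; have := divn_eq (n * p) q.
by move: nd; rewrite -lt0n; lia.
Qed.

(** Superadditivity makes the prefix sums of every rotation at least those of
    [s]. A rotation by [i] that fixes [s] is excluded by strict superadditivity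
    at [i + (q - i) = q]. *)
Lemma farey_lyndon p q (s : seq bool) : 0 < q -> coprime p q -> size s = q ->
  (forall n, psum s n = n * p %/ q) -> lyndon s.
Proof.
move=> q0 cpq ss ps; apply: lyndon_of_lt; rewrite ss // => i hi.
have R n : psum (rot i s) n = (i + n) * p %/ q - i * p %/ q.
  by rewrite -!ps psum_rot ?addKn // ss; lia.
rewrite lt_neqAle; apply/andP; split; last first.
  apply: lexi_psum; rewrite ?size_rot // => j _ _.
  by rewrite R ps; have := floor_super p q i j.+1; lia.
apply/eqP => e.
have := floor_super_lt (i := i) (n := q - i) cpq; rewrite -(ps (q - i)) e R.
rewrite subnKC ?dvdnn //; last by lia.
by move=> /(_ ltac:(lia) isT); have := floor_super p q i (q - i); rewrite subnKC; lia.
Qed.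

(** Let the rotation start at [i]. If [i = q], the missing one at [q] precedes
    the rotation and superadditivity settles all prefixes. Otherwise the
    rotation has [p] ones in its first [q] letters while [t] has [p - 1], so
    that only prefixes of length at most [q] matter; if the missing one falls
    into such a prefix, strict superadditivity makes up for it. *)
Lemma farey_bullet_lyndon d p q (t : seq bool) : 1 < d -> 0 < q -> coprime p q ->
  size t = d * q -> (forall n, psum t n + (n %% (d * q) == q) = n * p %/ q) ->
  lyndon t.
Proof.
move=> d1 q0 cpq st pt.
have qm : q < d * q by rewrite -{1}(mul1n q) ltn_pmul2r.
have m0 : 0 < d * q by lia.
have shift i : 0 < i < d * q -> ((i + q) %% (d * q) == q) = false.
  move=> hi; have [h|h] := ltnP (i + q) (d * q); first by rewrite modn_small //; lia.
  by rewrite -(subnK h) modnDr modn_small; lia.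
apply: lyndon_of_lt; rewrite st // => i hi.
have R n : psum (rot i t) n + psum t i = psum t (i + n).
  by rewrite psum_rot 1?addnC // st; lia.
have ti : psum t i + (i == q) = i * p %/ q by have := pt i; rewrite modn_small; lia.
have tq : psum t q + 1 = p by have := pt q; rewrite modn_small // eqxx mulKn.
have tiq : psum t (i + q) = i * p %/ q + p.
  by have := pt (i + q); rewrite shift // addn0 mulnDl (mulnC q) divnDMl.
rewrite lt_neqAle; apply/andP; split.
  by apply/eqP => e; have := R q; rewrite -e; lia.
apply: lexi_psum; rewrite ?size_rot ?st // => j hj E.
have := R j.+1; have := pt j.+1; have := pt (i + j.+1).
have := floor_super p q i j.+1.
case: (eqVneq i q) ti => [_|iq] /= ti; first by do 2!case: eqP; lia.
have [jq|jq] := ltnP j q; last by have := E q jq; have := R q; lia.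
case: (eqVneq ((i + j.+1) %% _) q) => [e|_]; last by do !case: eqP; lia.
rewrite (modn_small (m := j.+1)); last by lia.
have [->|nq] := eqVneq j.+1 q; first by have := R q; lia.
suff /(floor_super_lt cpq) : q %| i + j.+1 by lia.
by rewrite (divn_eq (i + j.+1) (d * q)) e dvdn_add ?dvdn_mull.
Qed.

(** The prefix sums of the complement of [s'] are [n * p / q] rounded up, which
    bounds those of every rotation of [s]. They are attained by the rotation at
    [i] where [i * p] is congruent to [-1] modulo [q]: from there, adding
    [n * p] crosses multiples of [q] as early as possible. *)
Lemma max_rot_farey p q (s s' : seq bool) : 0 < p < q -> coprime p q ->
  size s = q -> (forall n, psum s n = n * p %/ q) ->
  size s' = q -> (forall n, psum s' n = n * (q - p) %/ q) ->
  max_rot s = compl s'.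
Proof.
move=> hp cpq ss ps ss' ps'; have q0 : 0 < q by lia.
have C n : psum (compl s') n + n * (q - p) %/ q = n.
  by rewrite -ps' psum_compl // ss'.
have R i n : i <= q -> psum (rot i s) n + i * p %/ q = (i + n) * p %/ q.
  by move=> hi; rewrite -!ps psum_rot ?ss // addnC.
have up n : n * (q - p) %/ q * q <= n * (q - p) by exact: leq_trunc_div.
have mB n : n * (q - p) + n * p = n * q by rewrite -mulnDr; congr muln; lia.
apply: max_rot_eq => [i0|].
  have [i hi ->] := rotE i0 s; rewrite ss in hi.
  apply: lexi_psum; rewrite ?size_rot ?size_compl ?ss ?ss' // => j _ _.
  rewrite -(leq_add2r (i * p %/ q)) R //.
  rewrite -(leq_add2r (j.+1 * (q - p) %/ q)) addnAC C -ltnS -(ltn_pmul2r q0).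
  have := ltn_ceil (i * p) q0; have := leq_trunc_div ((i + j.+1) * p) q.
  have := up j.+1; have := mB j.+1; move: (_ %/ q) (_ %/ q) (_ %/ q) => a b c.
  rewrite [(i + _) * p]mulnDl; nia.
have [i hi [c ic]] : exists2 i, i <= q & exists c, i * p + 1 = c * q.
  pose x := chinese p q 0 (q - 1).
  have xp : p %| x by apply/eqP; rewrite chinese_modl // mod0n.
  have xq : x %% q = q - 1 by rewrite chinese_modr // modn_small //; lia.
  (* x is 0 modulo p and -1 modulo q, so x / p solves i * p = -1 mod q *)
  exists ((x %/ p) %% q); first by rewrite ltnW // ltn_mod.
  exists (((x %/ p) %% q * p + 1) %/ q); rewrite divnK // /dvdn.
  by rewrite -modnDml modnMml divnK // xq subnK // modnn.
exists i; apply: eq_psum; rewrite ?size_rot ?size_compl ?ss ?ss' // => n _.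
apply/eqP; rewrite -(eqn_add2r (i * p %/ q)) R //.
rewrite -(eqn_add2r (n * (q - p) %/ q)) addnAC C.
have := ltn_ceil (i * p) q0; have := ltn_ceil ((i + n) * p) q0.
have := ltn_ceil (n * (q - p)) q0; have := leq_trunc_div (i * p) q.
have := leq_trunc_div ((i + n) * p) q.
have := up n; have := mB n; move: (_ %/ q) (_ %/ q) (_ %/ q) => a b e.
rewrite [(i + _) * p]mulnDl => A1 A2 A3 A4 A5 A6 A7.
have ac : a.+1 = c.
  have : a < c by rewrite -(ltn_pmul2r q0); lia.
  have : c < a.+2 by rewrite -(ltn_pmul2r q0) !mulSn; move: A7; rewrite mulSn; lia.
  lia.
have : n + a < (b + e).+1 by rewrite -(ltn_pmul2r q0) !mulSn !mulnDl; lia.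
have : b + e < (n + a).+1 by rewrite -(ltn_pmul2r q0) !mulSn !mulnDl; lia.
lia.
Qed.

Lemma size_psum_farey_word (p q : nat) : 0 < p < q -> coprime p q ->
  size (farey_word (p%:Q / q%:Q)%R) = q /\
  forall n, psum (farey_word (p%:Q / q%:Q)%R) n = n * p %/ q.
Proof.
move=> hp cpq; set a := (_ / _)%R.
have q0 : (0 < q%:Q)%R by rewrite ltr0z; lia.
have da : `|denq a|%N = q.
  by rewrite /a coprimeq_den //; case: eqP => //; lia.
have a01 : (0 < a < 1)%R.
  by rewrite /a divr_gt0 ?ltr0z ?ltr_pdivrMr ?mul1r ?ltr_int //; lia.
have fl n : Num.floor (a *+ n)%R = Posz (n * p %/ q).
  apply: floorE; rewrite -mulr_natl /a mulrA ler_pdivlMr // ltr_pdivrMr //.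
  rewrite -!pmulrn natr1 -!natrM ler_nat ltr_nat leq_trunc_div ltn_ceil //; lia.
have ss : size (farey_word a) = q by rewrite size_mkseq.
split=> //.
have le n : n <= q -> psum (farey_word a) n = n * p %/ q.
  elim: n => [|n IH] hn; first by rewrite psum0 div0n.
  have := nth_farey_word a01 (j := n); rewrite da => /(_ hn).
  rewrite !fl psumS IH ?(ltnW hn) // /letter ss modn_small //.
  by case: nth; lia.
have cs : count_mem true (farey_word a) = p.
  by rewrite -psum_size ss le // mulKn //; lia.
move=> n; have -> : psum (farey_word a) n = n %/ q * p + psum (farey_word a) (n %% q).
  by rewrite -cs -psumD ss -divn_eq.
rewrite le; last by rewrite ltnW // ltn_mod; lia.
by rewrite {3}(divn_eq n q) mulnDl mulnAC divnMDl //; lia.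
Qed.

(** * The substitution by a Farey word *)

Lemma wminus_rcons s a : wminus (rcons s a) = rcons s false.
Proof. by rewrite /wminus size_rcons /=; elim: s => //= b s ->. Qed.

Lemma wplus_rcons s a : wplus (rcons s a) = rcons s true.
Proof. by rewrite /wplus size_rcons /=; elim: s => //= b s ->. Qed.

Lemma compl_wminus s : compl (wminus s) = wplus (compl s).
Proof.
by case: (lastP s) => // u a; rewrite wminus_rcons /compl !map_rcons wplus_rcons.
Qed.

Lemma compl_wplus s : compl (wplus s) = wminus (compl s).
Proof.
by case: (lastP s) => // u a; rewrite wplus_rcons /compl !map_rcons wminus_rcons.
Qed.

(** Complementation exchanges [s^-] with [L(s)^+] and [s] with [L(s)] between the
    two slopes, so it acts on a substituted word through the argument of the
    substitution. *)
Lemma compl_bullet s s' r : max_rot s = compl s' -> max_rot s' = compl s ->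
  compl (bullet s' r) = bullet s (compl r).
Proof.
move=> e e'; case: r => //= a r.
rewrite /compl map_cat map_flatten -!/(compl _); congr (_ ++ flatten _).
  by case: a; rewrite /= ?e' ?compl_wplus ?complK // compl_wminus e.
elim: r a => //= b r IH a; congr (_ :: _); last exact: IH.
by case: a b => [] []; rewrite /= ?e' ?e -/(compl _) ?compl_wplus ?complK // ?compl_wminus.
Qed.

Lemma count_take_cat n (u v : seq bool) : count_mem true (take n (u ++ v)) =
  count_mem true (take n u) + count_mem true (take (n - size u) v).
Proof.
rewrite take_cat; case: ltnP => h; last by rewrite count_cat (take_oversize h).
by rewrite (_ : n - size u = 0) ?take0 ?addn0 //; lia.
Qed.

Lemma count_take_wminus n (s : seq bool) : last false s = true ->
  count_mem true (take n (wminus s)) + (size s <= n) = count_mem true (take n s).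
Proof.
case: (lastP s) => // u a; rewrite last_rcons => ->; rewrite wminus_rcons size_rcons.
rewrite -!cats1 !count_take_cat; case: (ltnP (size u) n) => h.
  by rewrite -(subnSK h) /=; lia.
have -> : n - size u = 0 by lia.
by rewrite !take0 addn0.
Qed.

Lemma count_take_wplus n (s : seq bool) : 0 < size s -> last true s = false ->
  count_mem true (take n (wplus s)) = count_mem true (take n s) + (size s <= n).
Proof.
case: (lastP s) => // u a _; rewrite last_rcons => ->; rewrite wplus_rcons size_rcons.
rewrite -!cats1 !count_take_cat; case: (ltnP (size u) n) => h.
  by rewrite -(subnSK h) /=; lia.
have -> : n - size u = 0 by lia.
by rewrite !take0 !addn0.
Qed.

Lemma size_wminus (s : seq bool) : 0 < size s -> size (wminus s) = size s.
Proof. by case: (lastP s) => // u a _; rewrite wminus_rcons !size_rcons. Qed.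

Lemma size_wplus (s : seq bool) : 0 < size s -> size (wplus s) = size s.
Proof. by case: (lastP s) => // u a _; rewrite wplus_rcons !size_rcons. Qed.

Lemma last_farey p q (s : seq bool) b : 0 < p < q -> size s = q ->
  (forall n, psum s n = n * p %/ q) -> last b s = true.
Proof.
move=> hp ss ps; have sn : s <> [::] by move=> e; move: hp; rewrite -ss e /=; lia.
have := psumS s q.-1; rewrite /letter ss modn_small; last by lia.
rewrite -[X in nth _ _ X.-1]ss nth_last (_ : last false s = last b s); last by case: (s) sn.
rewrite prednK; last by lia.
rewrite !ps mulKn; last by lia.
have : q.-1 * p %/ q < p by rewrite ltn_divLR; nia.
by case: last; lia.
Qed.

(** For [0 < r < q] neither [r * p / q] nor [r - r * p / q] is an integer, so
    that the two fractional parts add up to one. *)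
Lemma floor_plus_floor_compl p q r : 0 < p < q -> coprime p q -> r < q ->
  r * p %/ q + r * (q - p) %/ q + (0 < r) = r.
Proof.
move=> hp cpq rq; have q0 : 0 < q by lia.
have [->|r0] := posnP r; first by rewrite !mul0n !div0n.
have nd : r * p %% q != 0.
  rewrite -/(q %| r * p) Gauss_dvdl ?(coprime_sym q) //.
  by apply/negP => /(dvdn_leq _); lia.
have xq := ltn_pmod (r * p) q0; have e := divn_eq (r * p) q.
move: nd xq e; move: (r * p %/ q) (r * p %% q) => a x nd xq e.
have ar : a < r by rewrite -(ltn_pmul2r q0); nia.
suff -> : r * (q - p) = (r - a - 1) * q + (q - x).
  by rewrite divnMDl // divn_small; lia.
rewrite mulnBr e !mulnBl; nia.
Qed.

Lemma bullet_max_word d s : 1 < d -> bullet s (false :: nseq (d - 1) true) =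
  wminus s ++ wplus (max_rot s) ++ wpow (d - 2) s.
Proof.
case: d => [|[|e]] // _; rewrite subn1 subn2 /wpow /=; congr (_ ++ (_ ++ flatten _)).
by elim: e => //= e ->.
Qed.

(** Writing [s = 0 u 1] and [L(s) = 1 u 0], the word is [0 u 0 1 u 1] followed by
    copies of [s]: the last one of the first copy of [s] has been moved one
    place to the right, which changes the power of [s] only in its prefix sum
    at [q]. *)
Lemma psum_bullet d p q (s s' : seq bool) : 1 < d -> 0 < p < q -> coprime p q ->
  size s = q -> (forall n, psum s n = n * p %/ q) ->
  size s' = q -> (forall n, psum s' n = n * (q - p) %/ q) ->
  let t := bullet s (false :: nseq (d - 1) true) in
  [/\ size t = d * q, count_mem true t = d * p &
      forall n, psum t n + (n %% (d * q) == q) = n * p %/ q].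
Proof.
move=> d1 hp cpq ss ps ss' ps'; rewrite (bullet_max_word _ d1).
case: d d1 => [|[|e]] // _; rewrite subn2.
rewrite (max_rot_farey hp cpq ss ps ss' ps'); set l := compl s'.
have q0 : 0 < q by lia.
have qm : q < e.+2 * q by rewrite -{1}(mul1n q) ltn_pmul2r.
have sl : size l = q by rewrite size_compl.
have pl r : psum l r + r * (q - p) %/ q = r by rewrite -ps' psum_compl // ss'.
set t := _ ++ _.
have st : size t = e.+2 * q.
  by rewrite !size_cat size_wminus ?size_wplus ?size_wpow ?ss ?sl // !mulSn.
have lasts : last false s = true by apply: last_farey hp ss ps.
have lastl : last true l = false.
  have : last false s' = true by apply: last_farey ss' ps'; lia.
  by rewrite /l /compl (last_map negb s' false) => ->.
have sq : count_mem true s = p by rewrite -psum_size ps ss mulKn.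
have lq : count_mem true l = p by rewrite count_compl -psum_size ps' ss' mulKn //; lia.
have ct n : n <= e.+2 * q -> psum t n + (n == q) = n * p %/ q.
  move=> hn; rewrite psum_take ?st // !count_take_cat.
  rewrite size_wminus ?size_wplus ?ss ?sl // count_take_wplus ?sl //.
  have := count_take_wminus n lasts; rewrite ss.
  move: (count_mem true (take n (wminus s))) => c.
  case: (ltnP n q) => nq.
    have -> : n - q = 0 by lia.
    rewrite sub0n !take0 leqNgt q0 /= -(psum_take (w := s)) ?ss ?(ltnW nq) // ps; lia.
  rewrite (take_oversize (s := s)) ?ss // sq.
  have -> : n * p %/ q = p + (n - q) * p %/ q.
    by rewrite -{1}(subnKC nq) mulnDl mulnC divnMDl.
  move: (n - q) (subnKC nq) => r rn; have -> : (n == q) = (r == 0) by lia.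
  case: (ltnP r q) => rq.
    have -> : r - q = 0 by lia.
    rewrite take0 -(psum_take (w := l)) ?sl ?(ltnW rq) //.
    by have := pl r; have := floor_plus_floor_compl hp cpq rq; case: r {rn rq} => [|r] /=; lia.
  rewrite (take_oversize (s := l)) ?sl // lq.
  have -> : (r == 0) = false by lia.
  have -> : r * p %/ q = p + (r - q) * p %/ q.
    by rewrite -{1}(subnKC rq) mulnDl mulnC divnMDl.
  rewrite -(psum_take (w := wpow e s)) ?size_wpow ?ss; last by move: hn; rewrite !mulSn; lia.
  case: (posnP e) => [e0|e1]; last first.
    by rewrite psum_wpow // ps; move: (_ %/ q) => x; lia.
  have -> : r - q = 0 by move: hn; rewrite e0 !mulSn; lia.
  by rewrite psum0 mul0n div0n; lia.
have cm : count_mem true t = e.+2 * p.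
  rewrite -psum_size st; have := ct _ (leqnn _).
  by rewrite -mulnA (mulnC q) mulnA mulnK //; case: eqP => //; lia.
split=> // n.
have -> : psum t n =
    n %/ (e.+2 * q) * (e.+2 * p) + psum t (n %% (e.+2 * q)).
  by rewrite -cm -psumD st -divn_eq.
have := ct _ (ltnW (ltn_pmod n (ltn_trans q0 qm))).
have -> : n * p %/ q =
    n %/ (e.+2 * q) * (e.+2 * p) + n %% (e.+2 * q) * p %/ q.
  rewrite {1}(divn_eq n (e.+2 * q)) mulnDl -divnMDl //; congr (_ %/ _); lia.
by rewrite -addnA => ->.
Qed.

Lemma is_max_farey p q (s : seq bool) : 0 < q -> coprime p q ->
  size s = q -> (forall n, psum s n = n * p %/ q) ->
  is_max (lyndon_words q p) s.
Proof.
move=> q0 cpq ss ps; split=> [|v [[_ le] sv cv]]; last exact: lyndon_le_farey sv cv ss ps.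
by split; [apply: farey_lyndon ps| |rewrite -psum_size ss ps mulKn].
Qed.

Lemma is_max_bullet d p q (s s' : seq bool) : 1 < d -> 0 < p < q -> coprime p q ->
  size s = q -> (forall n, psum s n = n * p %/ q) ->
  size s' = q -> (forall n, psum s' n = n * (q - p) %/ q) ->
  is_max (lyndon_words (d * q) (d * p)) (bullet s (false :: nseq (d - 1) true)).
Proof.
move=> d1 hp cpq ss ps ss' ps'; have q0 : 0 < q by lia.
have [st ct pt] := psum_bullet d1 hp cpq ss ps ss' ps'.
split=> [|v [vL sv cv]]; first by split=> //; apply: farey_bullet_lyndon pt.
have lt i : 0 < i < d * q -> ((v : word) < (rot i v : word))%O.
  by move=> hi; apply: lyndon_lt => //; rewrite sv.
exact: lyndon_le_farey_bullet d1 q0 lt sv cv ss ps st pt.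
Qed.

Theorem theorem3p1 (m k : nat) (hm : 2 <= m) (hk : 1 <= k <= m - 1) :
  (gcdn m k = 1 ->
     is_max (lyndon_words m k) (farey_word (k%:Q / m%:Q)%R) /\
     is_min (max_lyndon_words m k) (max_rot (farey_word (k%:Q / m%:Q)%R))) /\
  (forall d : nat, gcdn m k = d -> 2 <= d ->
     is_max (lyndon_words m k)
       (bullet (farey_word (k%:Q / m%:Q)%R) (false :: nseq (d - 1) true)) /\
     is_min (max_lyndon_words m k)
       (bullet (farey_word (k%:Q / m%:Q)%R) (true :: nseq (d - 1) false))).
Proof.
pose d := gcdn m k; pose p := k %/ d; pose q := m %/ d.
have d0 : 0 < d by rewrite gcdn_gt0; lia.
have km : k = d * p by rewrite mulnC divnK ?dvdn_gcdr.
have mm : m = d * q by rewrite mulnC divnK ?dvdn_gcdl.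
have cpq : coprime p q.
  have : d * gcdn q p = d * 1 by rewrite muln_gcdr -mm -km muln1.
  by move=> /eqP; rewrite eqn_pmul2l // coprime_sym.
have hp : 0 < p < q.
  by rewrite -[p < q](ltn_pmul2l d0) -km -mm; move: km; case: (p) => [|p'] e; lia.
have slope : (k%:Q / m%:Q = p%:Q / q%:Q)%R.
  rewrite {1}km {1}mm !PoszM !intrM -mulf_div divff ?mul1r // intr_eq0; lia.
have q0 : 0 < q by lia.
have hp' : 0 < q - p < q by lia.
have cpq' : coprime (q - p) q.
  have pq : p <= q by lia.
  by move: cpq; rewrite -{1 3}(subnKC pq) /coprime gcdnDl gcdnDr gcdnC.
have [ss ps] := size_psum_farey_word hp cpq.
have [ss' ps'] := size_psum_farey_word hp' cpq'.
have pqp : q - (q - p) = p by lia.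
rewrite slope; move: (farey_word _) (farey_word _) ss ps ss' ps' => s' s ss ps ss' ps'.
have ps2 n : psum s n = n * (q - (q - p)) %/ q by rewrite pqp.
have max_s : max_rot s = compl s' by apply: max_rot_farey hp cpq ss ps ss' ps'.
have max_s' : max_rot s' = compl s by apply: max_rot_farey hp' cpq' ss' ps' ss ps2.
split=> [e|_ <-].
  have mq : m = q by rewrite mm /d e mul1n.
  have kp : k = p by rewrite km /d e mul1n.
  rewrite mq kp; split; first exact: is_max_farey q0 cpq ss ps.
  rewrite max_s -{1}pqp; apply: is_min_max_lyndon; try lia.
  exact: is_max_farey q0 cpq' ss' ps'.
rewrite -/d => d2; split; first by rewrite {1}km {1}mm; exact: is_max_bullet ss ps ss' ps'.
have -> : bullet s (true :: nseq (d - 1) false) =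
    compl (bullet s' (false :: nseq (d - 1) true)).
  by rewrite (compl_bullet _ max_s max_s') /= /compl map_nseq.
rewrite {1}km {1}mm (_ : d * p = d * q - d * (q - p)); last first.
  by rewrite -mulnBr pqp.
apply: is_min_max_lyndon; rewrite ?leq_pmul2l; try lia.
exact: is_max_bullet ss' ps' ss ps2.
Qed.
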